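(* Let $\mathcal{C}$ be the set of all cluster points of a sequence $\{x_n\}$ in a cone metric space $(X,d)$. Let $r\in E$ with $0\ll r$ be such that for any $x\in X$ either $d(x,c)\le r$ or $r\ll d(x,c)$ for each $c\in\mathcal{C}$. Then $$LIM^{r}x_n\subset\bigcap_{c\in\mathcal{C}}\overline{B_r(c)}\subset\{x_0\in X:\mathcal{C}\subset\overline{B_r(x_0)}\}.$$
   Context: Let $E$ be a real Banach space. A subset $P\subset E$ is a cone if (i) $P$ is closed, nonempty and $P\neq\{0\}$; (ii) $a,b\in\mathbb{R}$, $a,b\ge 0$, $x,y\in P$ implies $ax+by\in P$; (iii) $x\in P$ and $-x\in P$ implies $x=0$. Write $x\le y$ if $y-x\in P$, $x<y$ if $x\le y$ and $x\ne y$, and $x\ll y$ if $y-x\in \mathrm{int}\,P$ (the interior of $P$). A cone metric space $(X,d)$ (associated with $E$ and $P$) is a nonempty set $X$ with a map $d:X\times X\to E$ such that for all $x,y,z\in X$: $0\le d(x,y)$, and $d(x,y)=0$ iff $x=y$; $d(x,y)=d(y,x)$; $d(x,y)\le d(x,z)+d(z,y)$. For $r\in E$ with $0\ll r$ or $r=0$, a sequence $\{x_n\}$ in $X$ is $r$-convergent to $x\in X$ if for every $\epsilon\in E$ with $0\ll\epsilon$ there is $k\in\mathbb{N}$ such that $d(x_n,x)\ll r+\epsilon$ for all $n\ge k$. The $r$-limit set is $LIM^{r}x_n=\{x\in X: \{x_n\}\text{ is } r\text{-convergent to } x\}$. A point $c\in X$ is a cluster point of $\{x_n\}$ if for every $\epsilon\in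 E$ with $0\ll\epsilon$ and every $k\in\mathbb{N}$ there is $k_1\in\mathbb{N}$ with $k_1>k$ and $d(x_{k_1},c)\ll\epsilon$. For $0\ll r$ and $y\in X$, $\overline{B_r(y)}=\{x\in X: d(x,y)\le r\}$. Intersections over $\mathcal{C}$ are taken as subsets of $X$ (so an empty intersection is $X$). *)

(* Defs.v *)
From HB Require Import structures.
From mathcomp Require Import all_boot all_order all_algebra.
From mathcomp Require Import all_classical all_reals all_analysis.

Set Implicit Arguments.
Unset Strict Implicit.
Unset Printing Implicit Defensive.

Import Order.TTheory GRing.Theory Num.Theory.
Import numFieldNormedType.Exports.

Local Open Scope classical_set_scope.
Local Open Scope ring_scope.

Record is_cone (R : realType) (E : completeNormedModType R) (P : set E) : Prop := {
  cone_closed : closed P ;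
  cone_nonempty : P !=set0 ;
  cone_nontrivial : P <> [set 0] ;
  cone_comb : forall (a b : R) (x y : E),
    0 <= a -> 0 <= b -> P x -> P y -> P (a *: x + b *: y) ;
  cone_pointed : forall x : E, P x -> P (- x) -> x = 0
}.

Definition cone_le (R : realType) (E : completeNormedModType R) (P : set E)
  (x y : E) : Prop := P (y - x).

Definition cone_ll (R : realType) (E : completeNormedModType R) (P : set E)
  (x y : E) : Prop := interior P (y - x).

Record is_cone_metric (R : realType) (E : completeNormedModType R) (P : set E)
    (X : Type) (d : X -> X -> E) : Prop := {
  cone_metric_nonempty : [set: X] !=set0 ;
  cone_metric_ge0 : forall x y : X, cone_le P 0 (d x y) ;
  cone_metric_eq0 : forall x y : X, d x y = 0 <-> x = y ;
  cone_metric_sym : forall x y : X, d x y = d y x ;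
  cone_metric_triangle : forall x y z : X, cone_le P (d x y) (d x z + d z y)
}.

Section RoughConvergence.
Variables (R : realType) (E : completeNormedModType R) (P : set E).
Variables (X : Type) (d : X -> X -> E).

(* Only meaningful for [r = 0] or [cone_ll P 0 r]. *)
Definition r_convergent (r : E) (u : nat -> X) (x : X) : Prop :=
  forall eps : E, cone_ll P 0 eps ->
    exists k : nat, forall n : nat, (k <= n)%N -> cone_ll P (d (u n) x) (r + eps).

Definition r_limit_set (r : E) (u : nat -> X) : set X :=
  [set x | r_convergent r u x].

Definition cluster_point (u : nat -> X) (c : X) : Prop :=
  forall eps : E, cone_ll P 0 eps ->
    forall k : nat, exists k1 : nat, (k < k1)%N /\ cone_ll P (d (u k1) c) eps.

Definition cluster_points (u : nat -> X) : set X := [set c | cluster_point u c].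

Definition cone_closed_ball (r : E) (y : X) : set X :=
  [set x | cone_le P (d x y) r].

End RoughConvergence.

(* Main.v *)
(** For a cluster point c and an r-limit x, choosing n large with u n within
    eps / 2 of c gives d(x, c) <= d(x, u n) + d(u n, c) << r + eps; letting eps
    tend to 0 along multiples of the interior point r, the closedness of the
    cone yields d(x, c) <= r. The second inclusion is the symmetry of d. *)

Require Import Defs.
From mathcomp Require Import all_boot all_order all_algebra.
From mathcomp Require Import all_classical all_reals all_analysis.

Import Order.TTheory GRing.Theory Num.Theory.
Import numFieldNormedType.Exports.

Local Open Scope classical_set_scope.
Local Open Scope ring_scope.

Section ConeOrder.
Context {R : realType} {E : completeNormedModType R} {P : set E}
  (hP : is_cone P).

Lemma cone_add (x y : E) : P x -> P y -> P (x + y).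
Proof.
by move=> Px Py; rewrite -[x]scale1r -[y]scale1r; exact: (cone_comb hP).
Qed.

Lemma cone_scale (a : R) (x : E) : 0 <= a -> P x -> P (a *: x).
Proof.
move=> a0 Px; rewrite -[a *: x]addr0 -(scale0r x).
exact: (cone_comb hP).
Qed.

Lemma cone_le_trans (y x z : E) :
  cone_le P x y -> cone_le P y z -> cone_le P x z.
Proof.
move=> Pxy Pyz; rewrite /cone_le -(subrKA y z).
exact: cone_add.
Qed.

Lemma cone_leD (x y z t : E) :
  cone_le P x y -> cone_le P z t -> cone_le P (x + z) (y + t).
Proof.
by move=> Pxy Pzt; rewrite /cone_le opprD addrACA; exact: cone_add.
Qed.

(** Scaling by [a^-1] is continuous, so the points it sends into [P] form a neighbourhood of
    [a *: x]; scaling back by [a] keeps them in the cone. *)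
Lemma cone_interior_scale (a : R) (x : E) :
  0 < a -> interior P x -> interior P (a *: x).
Proof.
move=> a0 Px.
have : nbhs (a *: x) [set z | P (a^-1 *: z)].
  apply: (@scaler_continuous R E a^-1 (a *: x)).
  by rewrite /= scalerA mulVf ?gt_eqF// scale1r.
apply: filterS => z /= Pz.
rewrite -[z]scale1r -(@mulfV _ a) ?gt_eqF// -scalerA.
by apply: cone_scale => //; exact: ltW.
Qed.

Lemma cone_of_add_eps (v r : E) : cone_ll P 0 r ->
  (forall eps, cone_ll P 0 eps -> P (v + eps)) -> P v.
Proof.
move=> r0 Pv.
(* [r] is interior, so [v] is the limit of [v + t *: r] as [t] decreases to 0. *)
have vcvg : v + t *: r @[t --> 0^'+] --> v.
  rewrite -[X in _ --> X]addr0 -[X in _ + X](scale0r r).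
  apply: cvgD; first exact: cvg_cst.
  apply: cvgZr_tmp; exact/cvg_at_right_filter/cvg_id.
apply: (@closed_cvg _ _ _ _ _ P (cone_closed hP) _ _ vcvg).
(* The right-sided filter at 0 gives [0 < t], which makes [t *: r] an admissible [eps]. *)
near=> t; apply: Pv.
rewrite /cone_ll subr0; apply: cone_interior_scale => //.
by rewrite /cone_ll subr0 in r0.
Unshelve. all: by end_near.
Qed.

End ConeOrder.

Lemma r_limit_dist_cluster_le (R : realType) (E : completeNormedModType R)
    (P : set E) (hP : is_cone P) (X : Type) (d : X -> X -> E)
    (hd : is_cone_metric P d) (u : nat -> X) (r : E) (x c : X) :
  cone_ll P 0 r -> r_convergent P d r u x -> cluster_point P d u c ->
  cone_le P (d x c) r.
Proof.
(* Here [v] is [r - d x c], the vector whose membership in [P] is the goal. *)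
move=> r0 ux uc; apply: (cone_of_add_eps hP _ _ r0) => eps eps0.
pose e := 2^-1 *: eps.
have e0 : cone_ll P 0 e.
  rewrite /cone_ll subr0; apply: (cone_interior_scale hP);
    first by rewrite invr_gt0.
  by rewrite /cone_ll subr0 in eps0.
(* The rank [k] is fixed first; clustering then supplies an index [n] beyond it, where both
   estimates hold. *)
have [k ukx] := ux e e0.
have [n [kn /interior_subset unc]] := uc e e0 k.
have /interior_subset unx := ukx n (ltnW kn).
(* In this form the goal is [cone_le P (d x c) (r + e + e)], with [r + e] bounding [d (u n) x] and
   [e] bounding [d (u n) c]. *)
have -> : r - d x c + eps = r + e + e - d x c.
  rewrite addrAC -(addrA r e); congr (_ + _ - _).
  by rewrite /e -scalerDl -[2^-1]mul1r -splitr scale1r.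
apply: (cone_le_trans hP _ _ _ (cone_metric_triangle hd x c (u n))).
rewrite (cone_metric_sym hd x); exact: cone_leD.
Qed.

Theorem theorem3p10 (R : realType) (E : completeNormedModType R) (P : set E)
    (hP : is_cone P) (X : Type) (d : X -> X -> E) (hd : is_cone_metric P d)
    (u : nat -> X) (r : E) (hr : cone_ll P 0 r)
    (hdich : forall (x c : X), cluster_points P d u c ->
       cone_le P (d x c) r \/ cone_ll P r (d x c)) :
  r_limit_set P d r u
    `<=` \bigcap_(c in cluster_points P d u) cone_closed_ball P d r c /\
  \bigcap_(c in cluster_points P d u) cone_closed_ball P d r c
    `<=` [set x0 | cluster_points P d u `<=` cone_closed_ball P d r x0].
Proof.
split=> x xr c hc.
  exact: (r_limit_dist_cluster_le _ _ _ hP _ _ hd _ _ _ _ hr xr hc).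
by rewrite /cone_closed_ball /= (cone_metric_sym hd); exact: xr.
Qed.
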